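(* Let $\lambda\in\mathbb{R}$, let $Y$ be a Bernoulli random variable with probability of success $p$, and let $x\in[0,1]$. For all integers $n\ge k\ge 0$, \[ \frac{B_{k,n}^{Y}(x|\lambda)}{k!}=\binom{n}{k}\binom{x}{k}_{\lambda}\sum_{l=0}^{n-k}p^{l}\binom{1-x}{l}l!\,{n-k \brace l}_{\lambda}. \]
   Context: For $\lambda\in\mathbb{R}$, $(x)_{0,\lambda}=1$, $(x)_{n,\lambda}=x(x-\lambda)\cdots(x-(n-1)\lambda)$ for $n\ge1$, $\binom{x}{k}_\lambda=\frac{(x)_{k,\lambda}}{k!}$, and $e_\lambda^x(t)=\sum_{n\ge0}(x)_{n,\lambda}\frac{t^n}{n!}$. The degenerate Stirling numbers of the second kind are given by $(x)_{n,\lambda}=\sum_{k=0}^n{n\brace k}_\lambda (x)_k$, where $(x)_k=x(x-1)\cdots(x-k+1)$. For the random variable $Y$, $E[e_\lambda^Y(t)]$ denotes the power series $\sum_{n\ge0}E[(Y)_{n,\lambda}]\frac{t^n}{n!}$ (constant term $1$); for real $a$, $(E[e_\lambda^Y(t)])^a=\sum_{j\ge0}\binom{a}{j}(E[e_\lambda^Y(t)]-1)^j$. The probabilistic degenerate Bernstein polynomials: $\frac{1}{k!}(x)_{k,\lambda}t^k(E[e_\lambda^Y(t)])^{1-x}=\sum_{n\ge k}B_{k,n}^{Y}(x|\lambda)\frac{t^n}{n!}$. *)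

(* Defs.v *)
From HB Require Import structures.
From mathcomp Require Import all_boot all_order all_algebra.
From mathcomp Require Import all_classical all_reals all_analysis.

Set Implicit Arguments.
Unset Strict Implicit.
Unset Printing Implicit Defensive.

Import Order.TTheory GRing.Theory Num.Theory.

Local Open Scope classical_set_scope.
Local Open Scope ring_scope.

Section FallingFactorials.
Variable R : realType.
Implicit Types (lam x a : R) (n k j : nat).

(* (x)_{n,lambda} *)
Definition dfact lam x n : R := \prod_(i < n) (x - i%:R * lam).

(* (x)_n, for real x *)
Definition ffactR x n : R := \prod_(i < n) (x - i%:R).

Definition dbinom lam x k : R := dfact lam x k / k`!%:R.

Definition binomR a j : R := ffactR a j / j`!%:R.

(* The identity is required at every real x, hence as polynomials in x. It
   determines S n k for k <= n and says nothing about S n k for k > n. *)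
Definition is_dstirling2 lam (S : nat -> nat -> R) :=
  forall n x, dfact lam x n = \sum_(k < n.+1) S n k * ffactR x k.

Lemma dstirling2_exists lam : exists S, is_dstirling2 lam S.
Proof.
pose fix S n k {struct n} : R :=
  match n, k with
  | 0, 0 => 1
  | 0, _.+1 => 0
  | n'.+1, 0 => (- (n'%:R * lam)) * S n' 0
  | n'.+1, k'.+1 => S n' k' + (k'.+1%:R - n'%:R * lam) * S n' k'.+1
  end.
have Sgt : forall n k, (n < k)%N -> S n k = 0.
  elim=> [|n IH] [|k] //= nk.
  by rewrite !IH ?mulr0 ?addr0 // ltnW.
exists S => n x; elim: n => [|n IH].
  by rewrite /dfact big_ord0 big_ord1 /ffactR big_ord0 mulr1.
have -> : dfact lam x n.+1 = dfact lam x n * (x - n%:R * lam).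
  by rewrite /dfact big_ord_recr.
have step k : S n k * ffactR x k * (x - n%:R * lam) =
    S n k * ffactR x k.+1 + (k%:R - n%:R * lam) * S n k * ffactR x k.
  have -> : ffactR x k.+1 = ffactR x k * (x - k%:R).
    by rewrite /ffactR big_ord_recr.
  rewrite -!mulrA (mulrCA _ (S n k)) -mulrDr; congr (_ * _).
  rewrite [X in _ = _ + X]mulrC -mulrDr; congr (_ * _).
  by rewrite addrA subrK.
rewrite IH mulr_suml; under eq_bigr do rewrite step.
rewrite big_split /= [RHS]big_ord_recl /=.
under [X in _ = _ + X]eq_bigr => k _.
  rewrite /bump /= add1n mulrDl; over.
rewrite big_split /= addrCA; congr (_ + _).
rewrite [LHS]big_ord_recl /= sub0r; congr (_ + _).
rewrite [RHS]big_ord_recr /= Sgt // mulr0 mul0r addr0.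
by apply: eq_bigr => k _; rewrite /bump /= add1n.
Qed.

Lemma dstirling2_unique lam S S' :
  is_dstirling2 lam S -> is_dstirling2 lam S' ->
  forall n k, (k <= n)%N -> S n k = S' n k.
Proof.
move=> HS HS' n k; elim/ltn_ind: k => k IH kn.
have := HS n k%:R; rewrite HS' => /eqP.
have lo (U : nat -> nat -> R) : \sum_(i < n.+1) U n i * ffactR k%:R i =
    \sum_(i < n.+1 | (i < k)%N) U n i * ffactR k%:R i + U n k * ffactR k%:R k.
  rewrite (bigID (fun i : 'I_n.+1 => (i < k)%N)) /=; congr (_ + _).
  have kn1 : (k < n.+1)%N by [].
  rewrite (bigD1 (Ordinal kn1)) /= ?ltnn // big1 ?addr0 // => i.
  rewrite -leqNgt => /andP[ki nik].
  have lki : (k < i)%N by rewrite ltn_neqAle ki andbT eq_sym; exact: nik.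
  by rewrite /ffactR (bigD1 (Ordinal lki)) //= subrr mul0r mulr0.
rewrite !lo => /eqP E.
have E1 : \sum_(i < n.+1 | (i < k)%N) S' n i * ffactR k%:R i =
    \sum_(i < n.+1 | (i < k)%N) S n i * ffactR k%:R i.
  by apply: eq_bigr => i ik; rewrite IH // -ltnS.
move: E; rewrite E1 => /addrI /mulIf -> //.
by apply/prodf_neq0 => i _; rewrite subr_eq0 eqr_nat neq_ltn ltn_ord orbT.
Qed.

End FallingFactorials.

(* F : fps R stands for the formal power series \sum_n F n * t^n. *)
Definition fps (R : realType) := nat -> R.

Section FormalPowerSeries.
Variable R : realType.
Implicit Types (F G : fps R) (a c : R) (n k j : nat).

(* t^k *)
Definition fpsXn k : fps R := fun n => (n == k)%:R.

Definition fps1 : fps R := fpsXn 0.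

Definition fps_sub F G : fps R := fun n => F n - G n.

Definition fps_scale c F : fps R := fun n => c * F n.

Definition fps_mul F G : fps R :=
  fun n => \sum_(i < n.+1) F i * G (n - i)%N.

Definition fps_exp F j : fps R := iter j (fps_mul F) fps1.

(* F^a = \sum_(j >= 0) binom(a, j) * (F - 1)^j, for F with constant term 1:
   (F - 1)^j then has no term of degree < j, so that the coefficient of t^n
   in the sum only involves j <= n; see fps_powE. *)
Definition fps_pow F a : fps R :=
  fun n => \sum_(j < n.+1) binomR a j * fps_exp (fps_sub F fps1) j n.

Lemma fps_exp_lt F j n : F 0%N = 0 -> (n < j)%N -> fps_exp F j n = 0.
Proof.
move=> F0; elim: j n => // j IH n nj.
rewrite /fps_exp iterS -/(fps_exp F j) /fps_mul big1 // => i _.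
case: (posnP i) => [->|i0]; first by rewrite F0 mul0r.
rewrite IH ?mulr0 //.
case: n i nj i0 => [|n] [i /= il] nj i0; first by case: i il i0.
by rewrite -ltnS; apply: leq_trans nj; rewrite ltnS ltn_subrL i0.
Qed.

Lemma fps_powE F a n N : F 0%N = 1 -> (n <= N)%N ->
  fps_pow F a n = \sum_(j < N.+1) binomR a j * fps_exp (fps_sub F fps1) j n.
Proof.
move=> F1 nN.
have G0 : fps_sub F fps1 0%N = 0 by rewrite /fps_sub F1 /fps1 /fpsXn eqxx subrr.
rewrite /fps_pow (big_ord_widen N.+1
  (fun j => binomR a j * fps_exp (fps_sub F fps1) j n)) ?ltnS //.
rewrite [RHS](bigID (fun j : 'I_N.+1 => (j < n.+1)%N)) /=.
rewrite [X in _ = _ + X]big1 ?addr0 // => i.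
by rewrite -leqNgt => ni; rewrite fps_exp_lt // mulr0.
Qed.

End FormalPowerSeries.

Section Probabilistic.
Context (d : measure_display) (T : measurableType d) (R : realType).
Variable P : probability T R.
Implicit Types (Y : {RV P >-> R}) (lam x p : R) (n k : nat).

(* As a probability, P {Y = 1} = p already forces 0 <= p <= 1. *)
Definition is_bernoulli Y p :=
  P [set w | Y w = 1] = p%:E /\ P [set w | Y w = 0] = (1 - p)%:E.

(* E[e_lambda^Y(t)]; fine is faithful as soon as (Y)_{n,lambda} is integrable,
   which holds for the (almost surely bounded) Bernoulli variables. *)
Definition mean_dexp lam Y : fps R :=
  fun n => fine 'E_P[fun w => dfact lam (Y w) n] / n`!%:R.

Lemma mean_dexp0 lam Y : mean_dexp lam Y 0%N = 1.
Proof.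
rewrite /mean_dexp fact0 divr1.
have -> : (fun w => dfact lam (Y w) 0) = cst 1.
  by apply/funext => w; rewrite /dfact big_ord0.
by rewrite expectation_cst.
Qed.

(* (1 / k!) (x)_{k,lambda} t^k (E[e_lambda^Y(t)])^(1 - x) *)
Definition dbernstein_gf lam Y k x : fps R :=
  fps_scale (dfact lam x k / k`!%:R)
    (fps_mul (@fpsXn R k) (fps_pow (mean_dexp lam Y) (1 - x))).

(* B_{k,n}^Y(x | lambda) *)
Definition dbernstein lam Y k n x : R := n`!%:R * dbernstein_gf lam Y k x n.

Lemma dbernstein_gfE lam Y k x n :
  dbernstein_gf lam Y k x n =
  if (k <= n)%N then dbernstein lam Y k n x / n`!%:R else 0.
Proof.
case: leqP => [_|nk].
  by rewrite /dbernstein mulrAC divff ?mul1r // pnatr_eq0 -lt0n fact_gt0.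
rewrite /dbernstein_gf /fps_scale /fps_mul big1 ?mulr0 // => i _.
rewrite /fpsXn (_ : (i : nat) == k = false) ?mul0r //.
by apply/negbTE; rewrite neq_ltn (leq_ltn_trans _ nk) // -ltnS.
Qed.

End Probabilistic.

(* Main.v *)
Require Import Defs.
From HB Require Import structures.
From mathcomp Require Import all_boot all_order all_algebra.
From mathcomp Require Import all_classical all_reals all_analysis.
From mathcomp Require Import measurable_realfun ring.

Set Implicit Arguments.
Unset Strict Implicit.
Unset Printing Implicit Defensive.

Import Order.TTheory GRing.Theory Num.Theory.

Local Open Scope classical_set_scope.
Local Open Scope ring_scope.

(** For a Bernoulli variable, E[(Y)_{n,lam}] = p (1)_{n,lam} for n >= 1, so
    that E[e_lam^Y(t)] - 1 = p (e_lam(t) - 1). Hence only the coefficients of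
    (e_lam(t) - 1)^l matter. The derivation D = (1 + lam t) d/dt satisfies
    D e_lam = e_lam, which gives
    D (e_lam - 1)^l = l ((e_lam - 1)^l + (e_lam - 1)^(l-1)); on coefficients
    this is the recurrence of the degenerate Stirling numbers, whence
    (e_lam - 1)^l / l! = \sum_n S(n, l) t^n / n!. *)

(** * The Stirling recurrence *)

Section DegenerateFactorials.
Variable R : realType.
Implicit Types (lam x : R) (S : nat -> nat -> R) (n k : nat).

Lemma dfactS lam x n : dfact lam x n.+1 = dfact lam x n * (x - n%:R * lam).
Proof. by rewrite /dfact big_ord_recr. Qed.

Lemma dfact0S lam n : dfact lam 0 n.+1 = 0.
Proof. by rewrite /dfact big_ord_recl mul0r subrr mul0r. Qed.

Lemma ffactRS x n : ffactR x n.+1 = ffactR x n * (x - n%:R).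
Proof. by rewrite /ffactR big_ord_recr. Qed.

(** Multiplying (x)_k by x - n lam = (x - k) + (k - n lam) raises it to (x)_{k+1} and leaves a
    multiple of (x)_k; comparing coefficients gives the recurrence. *)
Lemma is_dstirling2_rec lam S :
  (forall k, S 0%N k = (k == 0%N)%:R) ->
  (forall n, S n.+1 0%N = - (n%:R * lam) * S n 0%N) ->
  (forall n k, S n.+1 k.+1 = S n k + (k.+1%:R - n%:R * lam) * S n k.+1) ->
  (forall n k, (n < k)%N -> S n k = 0) ->
  is_dstirling2 lam S.
Proof.
move=> S0 Sn0 SS Sgt n x; elim: n => [|n IH].
  by rewrite /dfact big_ord0 big_ord1 S0 /ffactR big_ord0 mulr1.
rewrite dfactS {}IH mulr_suml.
(* The second sum may run up to n + 1 because [S n n.+1] vanishes; its range then matches the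
   goal. *)
transitivity (\sum_(k < n.+1) S n k * ffactR x k.+1 +
              \sum_(k < n.+2) (k%:R - n%:R * lam) * S n k * ffactR x k).
  rewrite [X in _ = _ + X]big_ord_recr /= Sgt // mulr0 mul0r addr0 -big_split /=.
  by apply: eq_bigr => k _; rewrite ffactRS; ring.
rewrite [X in _ + X = _]big_ord_recl [RHS]big_ord_recl /= Sn0 sub0r addrCA; congr (_ + _).
rewrite -big_split /=; apply: eq_bigr => k _.
by rewrite /bump /= add1n SS [RHS]mulrDl.
Qed.

End DegenerateFactorials.

(** * The derivation (1 + lam t) d/dt and powers of e_lam(t) - 1 *)

Section FormalDerivation.
Variables (R : realType) (lam : R).
Implicit Types (F G : fps R) (l n : nat).

(* (1 + lam t) d/dt *)
Definition fps_derl F : fps R :=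
  fun n => n.+1%:R * F n.+1 + lam * n%:R * F n.

(** Leibniz rule: in the coefficient of t^m, the weight m splits as i + (m - i) over the two factors
    ([euler]). In degree n + 1, each half loses a boundary term of weight 0 and can be reindexed. *)
Lemma fps_derlM F G n :
  fps_derl (fps_mul F G) n =
  fps_mul (fps_derl F) G n + fps_mul F (fps_derl G) n.
Proof.
have shiftl m : \sum_(i < m.+2) i%:R * F i * G (m.+1 - i)%N =
    \sum_(i < m.+1) i.+1%:R * F i.+1 * G (m - i)%N.
  rewrite big_ord_recl /= !mul0r add0r.
  by apply: eq_bigr => i _; rewrite /bump /= add1n subSS.
have shiftr m : \sum_(i < m.+2) F i * ((m.+1 - i)%:R * G (m.+1 - i)%N) =
    \sum_(i < m.+1) F i * ((m - i).+1%:R * G (m - i).+1).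
  rewrite big_ord_recr /= subnn mul0r mulr0 addr0.
  by apply: eq_bigr => i _; rewrite subSn // -ltnS.
have euler m : m%:R * fps_mul F G m =
    \sum_(i < m.+1) i%:R * F i * G (m - i)%N +
    \sum_(i < m.+1) F i * ((m - i)%:R * G (m - i)%N).
  rewrite /fps_mul mulr_sumr -big_split /=; apply: eq_bigr => i _.
  by rewrite natrB -1?ltnS //; ring.
rewrite /fps_derl -mulrA !euler shiftl shiftr mulrDr addrACA !mulr_sumr.
rewrite /fps_mul -!big_split /=.
by apply: eq_bigr => i _; ring.
Qed.

(* e_lam(t) - 1 *)
Definition dexp1 : fps R :=
  fun n => if n is 0 then 0 else dfact lam 1 n / n`!%:R.

Lemma fps_derl_dexp1 n : fps_derl dexp1 n = fps1 R n + dexp1 n.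
Proof.
have fn0 m : m`!%:R != 0 :> R by rewrite pnatr_eq0 -lt0n fact_gt0.
case: n => [|n].
  rewrite /fps_derl /fps1 /fpsXn /= mulr0 !addr0 dfactS /dfact big_ord0.
  by rewrite mul0r subr0 divr1 !mulr1.
rewrite /fps_derl /fps1 /fpsXn /= add0r dfactS factS natrM.
have n0 : 2 + n%:R != 0 :> R by rewrite -natrD pnatr_eq0.
by field; rewrite fn0 n0.
Qed.

Lemma fps_derl_exp_dexp1 l n :
  fps_derl (fps_exp dexp1 l) n =
  l%:R * (fps_exp dexp1 l n + fps_exp dexp1 l.-1 n).
Proof.
elim: l n => [|l IH] n.
  rewrite mul0r /fps_derl /fps_exp /= /fps1 /fpsXn /= mulr0 add0r.
  by case: n => [|n]; rewrite ?mulr0 ?mul0r.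
rewrite {1}/fps_exp iterS -/(fps_exp dexp1 l) fps_derlM /=.
have -> : fps_mul (fps_derl dexp1) (fps_exp dexp1 l) n =
    fps_exp dexp1 l n + fps_exp dexp1 l.+1 n.
  rewrite {1}/fps_mul; under eq_bigr do rewrite fps_derl_dexp1 mulrDl.
  rewrite big_split /= big_ord_recl big1 => [|i _]; last by rewrite mul0r.
  by rewrite mul1r addr0 subn0.
have -> : fps_mul dexp1 (fps_derl (fps_exp dexp1 l)) n =
    l%:R * (fps_exp dexp1 l.+1 n + fps_exp dexp1 l n).
  rewrite /fps_mul; under eq_bigr do rewrite IH mulrCA mulrDr.
  (* For l = 0 the truncated predecessor [l.-1] is harmless, as the factor l kills the term. *)
  rewrite -mulr_sumr; case: l {IH} => [|l]; first by rewrite !mul0r.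
  by rewrite big_split.
by rewrite -natr1 -[fps_mul dexp1 _ n]/(fps_exp dexp1 l.+1 n); ring.
Qed.

Lemma dstirling2_dexp1 :
  is_dstirling2 lam (fun n l => n`!%:R / l`!%:R * fps_exp dexp1 l n).
Proof.
have fn0 m : m`!%:R != 0 :> R by rewrite pnatr_eq0 -lt0n fact_gt0.
(* The derivation formula, solved for its top coefficient. *)
have rec n l : fps_exp dexp1 l n.+1 =
    (l%:R * (fps_exp dexp1 l n + fps_exp dexp1 l.-1 n) -
     lam * n%:R * fps_exp dexp1 l n) / n.+1%:R.
  by rewrite -fps_derl_exp_dexp1 /fps_derl addrK mulrC mulKf ?pnatr_eq0.
have gt n l : (n < l)%N -> fps_exp dexp1 l n = 0 by exact: fps_exp_lt.
have Sn0 m : 1 + m%:R != 0 :> R by rewrite nat1r pnatr_eq0.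
apply: is_dstirling2_rec => [k|n|n k|n k nk].
- case: k => [|k]; last by rewrite gt ?mulr0.
  by rewrite divr1 mul1r.
- rewrite rec factS natrM mul0r sub0r; field.
  by rewrite ?oner_neq0 ?Sn0.
- rewrite rec !factS !natrM /=; field.
  by rewrite ?fn0 ?Sn0.
- by rewrite gt ?mulr0.
Qed.

End FormalDerivation.

Section FpsScale.
Variable R : realType.
Implicit Types (F G : fps R) (c : R) (k l n : nat).

Lemma fps_exp_scale F c l n :
  fps_exp (fps_scale c F) l n = c ^+ l * fps_exp F l n.
Proof.
elim: l n => [|l IH] n; first by rewrite mul1r.
rewrite /fps_exp !iterS -/(fps_exp F l) -/(fps_exp _ l) /fps_mul mulr_sumr.
by apply: eq_bigr => i _; rewrite IH exprS /fps_scale; ring.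
Qed.

Lemma fps_mulXn k F n : (k <= n)%N -> fps_mul (@fpsXn R k) F n = F (n - k)%N.
Proof.
move=> kn; have kn1 : (k < n.+1)%N by [].
rewrite /fps_mul (bigD1 (Ordinal kn1)) //= /fpsXn eqxx mul1r big1 ?addr0 //.
by move=> i; rewrite -val_eqE /= => /negbTE ->; rewrite mul0r.
Qed.

End FpsScale.

(** * Expectations under a Bernoulli variable *)

Section BernoulliMean.
Context (d : measure_display) (T : measurableType d) (R : realType).
Variables (P : probability T R) (Y : {RV P >-> R}) (p : R).
Hypothesis hY : is_bernoulli Y p.

(** The two events are disjoint and their probabilities p and 1 - p add up to 1, so the complement
    of their union is null. *)
Lemma bernoulli_ae : {ae P, forall w, Y w = 1 \/ Y w = 0}.
Proof.
have [h1 h0] := hY.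
have m1 : measurable [set w | Y w = 1].
  exact: (measurable_funPTI Y (measurable_set1 1)).
have m0 : measurable [set w | Y w = 0].
  exact: (measurable_funPTI Y (measurable_set1 0)).
exists (~` ([set w | Y w = 1] `|` [set w | Y w = 0])); split => //.
- by apply: measurableC; apply: measurableU.
- rewrite probability_setC; last exact: measurableU.
  have dis : [set w | Y w = 1] `&` [set w | Y w = 0] = set0.
    by apply/seteqP; split => w //= [-> /eqP]; rewrite oner_eq0.
  have /(_ _ _ m1 m0 dis) -> := @measureU _ _ _ P.
  apply: etrans (congr1 (fun u => 1 - u)%E (congr2 adde h1 h0)) _.
  by rewrite -EFinD subrKC /= subrr.
Qed.

(** As f vanishes at 0, f(Y) agrees almost surely with f(1) times the indicator of Y = 1. *)
Lemma expectation_bernoulli (f : R -> R) :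
  measurable_fun setT f -> f 0 = 0 ->
  ('E_P[fun w => f (Y w)] = (p * f 1)%:E)%E.
Proof.
move=> mf f0; have [h1 _] := hY.
pose A := [set w | Y w = 1].
have mA : measurable A by exact: (measurable_funPTI Y (measurable_set1 1)).
rewrite unlock (ae_eq_integral (fun w => (f 1)%:E * (\1_A w)%:E)%E) //.
- rewrite integralZl //; last exact: integrable_indic.
  rewrite integral_indic // setIT mulrC EFinM; congr (_ * _)%E; exact: h1.
- by apply/measurable_EFinP; exact: measurableT_comp.
- apply: emeasurable_funM => //; apply/measurable_EFinP.
  exact: measurable_indic.
- apply: filterS bernoulli_ae => w h _; rewrite -EFinM; congr EFin.
  case: h => Yw.
  + by rewrite indicE mem_set // mulr1 Yw.
  + rewrite Yw f0 indicE memNset ?mulr0 // /A /= Yw => /esym/eqP.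
    by rewrite oner_eq0.
Qed.

Lemma measurable_dfact (lam : R) n :
  measurable_fun setT (fun x : R => dfact lam x n).
Proof.
by apply: measurable_prod => i _; exact: measurable_funB.
Qed.

Lemma mean_dexp_bernoulli lam :
  fps_sub (mean_dexp lam Y) (fps1 R) = fps_scale p (dexp1 lam).
Proof.
apply/funext => -[|n]; rewrite /fps_sub /fps_scale /=.
  by rewrite mean_dexp0 subrr mulr0.
rewrite /mean_dexp.
rewrite (expectation_bernoulli (measurable_dfact lam n.+1)) ?dfact0S //.
by rewrite /fps1 /fpsXn subr0 mulrA.
Qed.

End BernoulliMean.

Theorem theorem2p10 (d : measure_display) (T : measurableType d)
    (R : realType) (P : probability T R) (Y : {RV P >-> R})
    (lam p x : R) (S : nat -> nat -> R) (n k : nat)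
    (hY : is_bernoulli Y p)
    (hx : 0 <= x <= 1)
    (hS : is_dstirling2 lam S)
    (hkn : (k <= n)%N) :
  dbernstein lam Y k n x / k`!%:R =
  'C(n, k)%:R * dbinom lam x k *
  \sum_(l < (n - k).+1) p ^+ l * binomR (1 - x) l * l`!%:R * S (n - k)%N l.
Proof.
have fn0 m : m`!%:R != 0 :> R by rewrite pnatr_eq0 -lt0n fact_gt0.
rewrite /dbernstein /dbernstein_gf /fps_scale fps_mulXn // /fps_pow.
rewrite (mean_dexp_bernoulli hY).
have -> : \sum_(l < (n - k).+1)
      p ^+ l * binomR (1 - x) l * l`!%:R * S (n - k)%N l =
    (n - k)`!%:R * \sum_(l < (n - k).+1)
      binomR (1 - x) l * fps_exp (fps_scale p (dexp1 lam)) l (n - k)%N.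
  rewrite mulr_sumr; apply: eq_bigr => l _; rewrite fps_exp_scale.
  (* [S] is determined only for l <= n - k, which is the range of the sum. *)
  rewrite (dstirling2_unique hS (dstirling2_dexp1 lam)) -1?ltnS //.
  by field; rewrite fn0.
(* Writing n! as C(n, k) k! (n - k)! leaves only factorials to cancel. *)
rewrite -(bin_fact hkn) !natrM /dbinom.
by field; rewrite fn0.
Qed.
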